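(* Let $G$ be a finite group. Then the following are equivalent. (a) $\mathcal{E}(G)$ has an induced $4$-cycle; (b) $G$ has a subgroup $H$ of the form $H=AB$, where $A,B\leq G$ satisfy the following conditions: (i) $A=\langle a_1,a_2\rangle$ and $B=\langle b_1,b_2\rangle$ are both non-cyclic; (ii) $A$ and $B$ centralise each other; (iii) for $i,j\in\{1,2\}$, the orders $|a_i|$ and $|b_j|$ are prime powers, and $\gcd(|a_i|,|b_j|)=1$.
   Context: The enhanced power graph $\mathcal{E}(G)$ of a group $G$ is the (simple, undirected) graph with vertex set $G$ in which $\{x,y\}$ is an edge if and only if $x\neq y$ and $\langle x,y\rangle$ is cyclic. An induced $4$-cycle is an induced subgraph isomorphic to the cycle $C_4$ on four vertices. *)

(* Defs.v *)
From mathcomp Require Import all_boot all_fingroup all_solvable.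
Set Implicit Arguments.
Unset Strict Implicit.
Unset Printing Implicit Defensive.
Local Open Scope group_scope.

(* Simple graphs are given by a vertex set [V : {set T}] together with an
   adjacency relation on the ambient type [T]. The enhanced power graph of
   [G : {group gT}] has vertex set [G] and the following adjacency relation. *)
Definition enhanced_power_rel (gT : finGroupType) (G : {group gT}) : rel gT :=
  [rel x y | [&& x \in G, y \in G, x != y & cyclic <<[set x; y]>>]].

Definition cycle4_rel : rel 'I_4 :=
  [rel i j : 'I_4 | (j == i.+1 %% 4 :> nat) || (i == j.+1 %% 4 :> nat)].

(* The subgraph of [(V, e)] induced on some [S \subset V] is isomorphic, via
   [f], to the graph on all of [U] with adjacency [c]. *)
Definition has_induced_subgraph (T U : finType) (V : {set T}) (e : rel T)
    (c : rel U) : Prop :=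
  exists (S : {set T}) (f : U -> T),
    [/\ S \subset V, injective f, f @: [set: U] = S
      & forall u v : U, e (f u) (f v) = c u v].

Definition prime_power (n : nat) : Prop :=
  exists p k : nat, [/\ prime p, (0 < k)%N & n = (p ^ k)%N].

(* Main.v *)
Require Import Defs.
From mathcomp Require Import all_boot all_fingroup all_solvable.
Local Open Scope group_scope.

(** Write an induced 4-cycle as x1 - y1 - x2 - y2 - x1.  Edges make every
    subgroup generated by one x and one y cyclic, while the two diagonals say
    that x1, x2, and likewise y1, y2, generate a non-cyclic subgroup.  What
    separates this from (b) is that the four orders need not be prime powers,
    nor coprime across the two sides, so the point is to replace each element
    by a well-chosen primary constituent.

    A non-cyclic <x1, x2> stays non-cyclic after passing to suitable primary
    constituents of x1 and x2 ([noncyclic_gen2_constt]): a failure to commute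
    is detected on constituents, and if x1 and x2 commute, some Sylow subgroup
    of the abelian group <x1, x2> is non-cyclic and it is generated by the
    constituents for a single prime.  Choose such constituents for the pair of
    x's and for the pair of y's.  No prime occurs on both sides
    ([noncyclic_constt_neq]): in the cyclic group <xi, yj> the p-subgroups form
    a chain, so if p occurred for xi and for yj, one of the two p-constituents
    would be a power of the other.  That would push one of the chosen
    non-cyclic subgroups into a cyclic group given by an edge.  Hence the
    orders on the two sides are coprime, and A and B centralise each other
    because the generators xi and yj of the cyclic group of an edge commute.

    Conversely a1 - b1 - a2 - b2 - a1 is an induced 4-cycle: commuting elements
    of coprime orders generate a cyclic group. *)

(** * Two-generated subgroups and primary constituents *)

Section Constituents.

Variable gT : finGroupType.
Implicit Types (G : {group gT}) (x y z : gT) (p q : nat).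

Lemma gen2_subG G x y : x \in G -> y \in G -> <<[set x; y]>> \subset G.
Proof. by move=> Gx Gy; rewrite gen_subG subUset !sub1set Gx. Qed.

Lemma mem_gen2l x y : x \in <<[set x; y]>>.
Proof. by rewrite mem_gen ?set21. Qed.

Lemma mem_gen2r x y : y \in <<[set x; y]>>.
Proof. by rewrite mem_gen ?set22. Qed.

Lemma gen2C x y : <<[set x; y]>> = <<[set y; x]>>.
Proof. by rewrite setUC. Qed.

Lemma mem_constt G (pi : nat_pred) x : x \in G -> x.`_pi \in G.
Proof. by move=> Gx; rewrite groupX. Qed.

Lemma cyclic_gen2S x y x' y' :
    x' \in <<[set x; y]>> -> y' \in <<[set x; y]>> ->
  cyclic <<[set x; y]>> -> cyclic <<[set x'; y']>>.
Proof. by move=> x'K y'K; apply: cyclicS; apply: gen2_subG. Qed.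

Lemma noncyclic_gen2_neq x y : ~~ cyclic <<[set x; y]>> -> x != y.
Proof.
by apply: contra => /eqP->; rewrite setUid; apply: cycle_cyclic.
Qed.

Lemma noncyclic_gen2_neq1 x y : ~~ cyclic <<[set x; y]>> -> x != 1.
Proof.
apply: contra => /eqP->; apply: cyclicS (cycle_cyclic y).
by rewrite gen2_subG ?cycle_id.
Qed.

Lemma cyclic_gen2_commute x y : cyclic <<[set x; y]>> -> commute x y.
Proof.
move=> /cyclic_abelian/centsP cK; apply: cK; [exact: mem_gen2l|exact: mem_gen2r].
Qed.

(** The product of two commuting elements of coprime orders generates the same
    subgroup as the pair. *)
Lemma cyclic_gen2_coprime x y :
  commute x y -> coprime #[x] #[y] -> cyclic <<[set x; y]>>.
Proof.
move=> cxy co; apply: cyclicS (cycle_cyclic (x * y)).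
apply: gen2_subG; rewrite /= cycleM //.
  by rewrite -{1}[x]mulg1 mem_mulg ?cycle_id.
by rewrite -{1}[y]mul1g mem_mulg ?cycle_id.
Qed.

(** An element is the product of its primary constituents. *)
Lemma constt_notin G x : x \notin G -> exists p : nat, x.`_p \notin G.
Proof.
move=> nGx; have /existsP[p np] : [exists p : 'I_#[x].+1, x.`_p \notin G].
  apply: contraR nGx; rewrite negb_exists => /forallP allG.
  rewrite -[x]prod_constt big_mkord group_prod // => i _.
  by have := allG i; rewrite negbK.
by exists p.
Qed.

(** In an abelian group taking p-constituents is multiplicative, so the
    p-constituents of generators generate the Sylow p-subgroup. *)
Lemma pelt_gen2_constt p x y z :
    commute x y -> z \in <<[set x; y]>> -> p.-elt z ->
  z \in <<[set x.`_p; y.`_p]>>.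
Proof.
move=> cxy; have cC : <[y]> \subset 'C(<[x]>).
  by rewrite cycle_subG /= cent_cycle; apply/cent1P.
rewrite -[<<[set x; y]>>]/([set x] <*> [set y]) -joing_idl -joing_idr cent_joinEr //.
case/mulsgP=> _ _ /cycleP[i ->] /cycleP[j ->] -> pz.
rewrite -(constt_p_elt pz) consttM; last exact/commuteX/commute_sym/commuteX.
by rewrite !consttX groupM // groupX // ?mem_gen2l ?mem_gen2r.
Qed.

(** Two obstructions to cyclicity are each visible on constituents: an element
    not centralising another has a constituent that does not, and an abelian
    group is cyclic as soon as its Sylow subgroups are. *)
Lemma noncyclic_gen2_constt x y :
    ~~ cyclic <<[set x; y]>> ->
  exists p q : nat, ~~ cyclic <<[set x.`_p; y.`_q]>>.
Proof.
move=> ncK; have [cxy | ncxy] := boolP (x \in 'C[y]).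
  have cK : abelian <<[set x; y]>>.
    rewrite abelian_gen; apply/centsP=> u + v.
    by move=> /set2P[]-> /set2P[]-> //; [|apply: commute_sym]; apply/cent1P.
  have : ~~ Zgroup <<[set x; y]>>.
    by apply: contra ncK => /nil_Zgroup_cyclic; apply; apply: abelian_nil.
  case/forall_inPn=> V /SylowP[p _ sylV] ncV; exists p, p.
  apply: contra ncV; apply: cyclicS; apply/subsetP=> z Vz.
  apply: pelt_gen2_constt; first exact/cent1P.
    exact: subsetP (pHall_sub sylV) z Vz.
  exact: mem_p_elt (pHall_pgroup sylV) Vz.
have [p ncxp] := constt_notin _ _ ncxy.
rewrite cent1C in ncxp; have [q ncyq] := constt_notin _ _ ncxp.
by exists p, q; apply: contra ncyq => /cyclic_gen2_commute c; apply/cent1P.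
Qed.

(** Subgroups of a cyclic group are ordered by divisibility of their orders, so
    its p-subgroups form a chain. *)
Lemma cyclic_gen2_constt_chain p x y :
  cyclic <<[set x; y]>> -> x.`_p \in <[y]> \/ y.`_p \in <[x]>.
Proof.
move=> cK; have sub z : z \in <<[set x; y]>> -> <[z.`_p]> \subset <<[set x; y]>>.
  by move=> Kz; rewrite cycle_subG; apply: mem_constt.
have sx := sub _ (mem_gen2l x y); have sy := sub _ (mem_gen2r x y).
have dvd_sub (u v : gT) : <[u.`_p]> \subset <[v.`_p]> -> u.`_p \in <[v]>.
  by rewrite cycle_subG => /cycleP[i ->]; apply/groupX/mem_constt/cycle_id.
have [i oi] := p_natP (p_elt_constt p x : p.-nat #[x.`_p]).
have [j oj] := p_natP (p_elt_constt p y : p.-nat #[y.`_p]).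
have [lij | lji] := leqP i j; [left | right]; apply: dvd_sub.
  by rewrite -(cardSg_cyclic cK) // -!orderE oi oj dvdn_exp2l.
by rewrite -(cardSg_cyclic cK) // -!orderE oi oj dvdn_exp2l // ltnW.
Qed.

(** For p = q the chain property puts one constituent, say that of x, inside
    the cyclic group generated by y; then it generates together with x' a
    subgroup of <y, x'>, which is cyclic. *)
Lemma noncyclic_constt_neq p q x y x' y' :
    cyclic <<[set x; y]>> -> cyclic <<[set y; x']>> ->
    cyclic <<[set x; y']>> ->
    ~~ cyclic <<[set x.`_p; x']>> -> ~~ cyclic <<[set y.`_q; y']>> ->
  p != q.
Proof.
have gen2S (u v w : gT) : u \in <[v]> -> cyclic <<[set v; w]>> -> cyclic <<[set u; w]>>.
  move=> /cycleP[i ->]; apply: cyclic_gen2S; last exact: mem_gen2r.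
  by apply: groupX; apply: mem_gen2l.
move=> cxy cyx' cxy' ncx ncy; apply/eqP=> epq; rewrite -{q}epq in ncy.
have [xy | yx] := cyclic_gen2_constt_chain p x y cxy.
  by rewrite (gen2S _ _ _ xy cyx') in ncx.
by rewrite (gen2S _ _ _ yx cxy') in ncy.
Qed.

Lemma prime_power_order_constt p x : x.`_p != 1 -> prime_power #[x.`_p].
Proof.
rewrite -order_gt1 => xp1; have px := p_elt_constt p x : p.-nat #[x.`_p].
have [k ok] := p_natP px; exists p, k; split=> //.
  (* The index p is prime because the order is not 1 and p is its only prime
     divisor. *)
  have /(pnatPpi px)/eqP<- : pdiv #[x.`_p] \in \pi(#[x.`_p]) by rewrite pi_pdiv.
  exact: pdiv_prime.
by move: xp1; rewrite ok; case: k {ok}.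
Qed.

Lemma coprime_order_constt p q x y : p != q -> coprime #[x.`_p] #[y.`_q].
Proof.
move=> npq; apply: pnat_coprime (p_elt_constt p x) _.
by apply: pi_pnat (p_elt_constt q y) _; rewrite !inE eq_sym.
Qed.

Lemma prime_power_gt1 n : prime_power n -> (1 < n)%N.
Proof.
by case=> p [[|k] [p_pr // _ ->]]; rewrite -(exp1n k.+1) ltn_exp2r ?prime_gt1.
Qed.

(** Equal elements of coprime orders are trivial. *)
Lemma coprime_prime_power_neq x y :
  prime_power #[x] -> gcdn #[x] #[y] = 1%N -> x != y.
Proof.
move=> /prime_power_gt1 x1; apply: contra_eq_neq => <-.
by rewrite gcdnn neq_ltn x1 orbT.
Qed.

(** * The enhanced power graph *)

Lemma enhanced_power_edgeP G x y :
    x \in G -> y \in G -> x != y ->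
  enhanced_power_rel G x y = cyclic <<[set x; y]>>.
Proof. by move=> Gx Gy nxy; rewrite /enhanced_power_rel /= Gx Gy nxy. Qed.

End Constituents.

Theorem proposition4p14 (gT : finGroupType) (G : {group gT}) :
  has_induced_subgraph G (enhanced_power_rel G) cycle4_rel
  <->
  exists (H A B : {group gT}) (a1 a2 b1 b2 : gT),
    [/\ [/\ H \subset G, A \subset G, B \subset G & H = A * B :> {set gT}],
        [/\ A = <<[set a1; a2]>> :> {set gT}, B = <<[set b1; b2]>> :> {set gT},
            ~~ cyclic A & ~~ cyclic B],
        A \subset 'C(B) /\ B \subset 'C(A)
      & forall x y : gT, x \in [set a1; a2] -> y \in [set b1; b2] ->
          [/\ prime_power #[x], prime_power #[y] & gcdn #[x] #[y] = 1%N]].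
Proof.
split.
- case=> S [f [sSG inj_f fS edge]].
  have Gf u : f u \in G by rewrite (subsetP sSG) // -fS imset_f ?inE.
  have edgeE u v : u != v -> cyclic <<[set f u; f v]>> = cycle4_rel u v.
    by move=> nuv; rewrite -edge enhanced_power_edgeP // (inj_eq inj_f).
  pose v i : 'I_4 := inord i.
  have vE i j : (i < 4)%N -> (j < 4)%N -> i != j ->
      cyclic <<[set f (v i); f (v j)]>> = (j == i.+1 %% 4) || (i == j.+1 %% 4).
    by move=> i4 j4 nij; rewrite edgeE /cycle4_rel /= -?val_eqE /= !inordK.
  move: (vE 0 1 isT isT isT)%N (vE 1 2 isT isT isT)%N (vE 2 3 isT isT isT)%N
    (vE 0 3 isT isT isT)%N (vE 0 2 isT isT isT)%N (vE 1 3 isT isT isT)%N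
    (Gf (v 0%N)) (Gf (v 1%N)) (Gf (v 2%N)) (Gf (v 3%N)).
  move: (f (v 0%N)) (f (v 1%N)) (f (v 2%N)) (f (v 3%N)).
  move=> x1 y1 x2 y2 c11 c21 c22 c12 /negbT ncx /negbT ncy Gx1 Gy1 Gx2 Gy2.
  have [p1 [p2 ncA]] := noncyclic_gen2_constt _ _ _ ncx.
  have [q1 [q2 ncB]] := noncyclic_gen2_constt _ _ _ ncy.
  have ncA' := ncA; have ncB' := ncB; rewrite gen2C in ncA'; rewrite gen2C in ncB'.
  (* An x and a y generate a cyclic subgroup, and still do when one or both
     are replaced by constituents. *)
  have cc (x y : gT) (p q : nat_pred) : cyclic <<[set x; y]>> ->
      cyclic <<[set x.`_p; y.`_q]>>.
    by apply: cyclic_gen2S; apply: mem_constt; [apply: mem_gen2l|apply: mem_gen2r].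
  have ccr (x y : gT) (p : nat_pred) : cyclic <<[set x; y]>> ->
      cyclic <<[set x; y.`_p]>>.
    by apply: cyclic_gen2S; [apply: mem_gen2l|apply: mem_constt; apply: mem_gen2r].
  have c11' := c11; have c12' := c12; have c22' := c22; have c21' := c21.
  rewrite gen2C in c11'; rewrite gen2C in c12'; rewrite gen2C in c22'.
  rewrite gen2C in c21'.
  have n11 : p1 != q1.
    by apply: noncyclic_constt_neq ncA ncB => //; apply: ccr.
  have n12 : p1 != q2.
    by apply: noncyclic_constt_neq ncA ncB' => //; apply: ccr.
  have n21 : p2 != q1.
    by apply: noncyclic_constt_neq ncA' ncB => //; apply: ccr.
  have n22 : p2 != q2.
    by apply: noncyclic_constt_neq ncA' ncB' => //; apply: ccr.
  pose A := <<[set x1.`_p1; x2.`_p2]>>%G; pose B := <<[set y1.`_q1; y2.`_q2]>>%G.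
  have sAG : A \subset G by rewrite gen2_subG ?mem_constt.
  have sBG : B \subset G by rewrite gen2_subG ?mem_constt.
  have cAB : A \subset 'C(B).
    rewrite cent_gen gen_subG; apply/centsP=> a aA b bB.
    apply: cyclic_gen2_commute.
    by case/set2P: aA => ->; case/set2P: bB => ->; apply: cc.
  exists (A <*> B)%G, A, B, x1.`_p1, x2.`_p2, y1.`_q1, y2.`_q2; split=> //.
  + by split=> //; [rewrite join_subG sAG|rewrite /= cent_joinEl].
  + by split=> //; rewrite centsC.
  move=> a b /set2P aA /set2P bB; split.
  + by case: aA => ->; apply: prime_power_order_constt;
       [apply: noncyclic_gen2_neq1 ncA|apply: noncyclic_gen2_neq1 ncA'].
  + by case: bB => ->; apply: prime_power_order_constt;
       [apply: noncyclic_gen2_neq1 ncB|apply: noncyclic_gen2_neq1 ncB'].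
  by apply/eqP; case: aA => ->; case: bB => ->; apply: coprime_order_constt.
case=> H [A [B [a1 [a2 [b1 [b2 [[_ sAG sBG _] [defA defB ncA ncB]]]]]]]].
case=> cAB _ ord; rewrite defA in ncA; rewrite defB in ncB.
have Aa a : a \in [set a1; a2] -> a \in A by rewrite defA; apply: mem_gen.
have Bb b : b \in [set b1; b2] -> b \in B by rewrite defB; apply: mem_gen.
have nab a b : a \in [set a1; a2] -> b \in [set b1; b2] -> a != b.
  by move=> aA bB; have [pa _ co] := ord a b aA bB; apply: coprime_prime_power_neq.
have cab a b : a \in [set a1; a2] -> b \in [set b1; b2] ->
    cyclic <<[set a; b]>>.
  move=> aA bB; have [_ _ /eqP co] := ord a b aA bB.
  by apply: cyclic_gen2_coprime => //; apply: (centsP cAB); [apply: Aa|apply: Bb].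
have [a1A a2A] := (set21 a1 a2, set22 a1 a2).
have [b1B b2B] := (set21 b1 b2, set22 b1 b2).
pose s := [:: a1; b1; a2; b2].
have uniq_s : uniq s.
  rewrite /= !inE !negb_or (noncyclic_gen2_neq _ _ _ ncA).
  by rewrite (noncyclic_gen2_neq _ _ _ ncB) [b1 == a2]eq_sym !nab.
pose f (i : 'I_4) := nth 1 s i.
have Gf i : f i \in G.
  have : f i \in s by rewrite mem_nth.
  by rewrite !inE => /or4P[]/eqP->;
    [apply/(subsetP sAG)/Aa|apply/(subsetP sBG)/Bb
    |apply/(subsetP sAG)/Aa|apply/(subsetP sBG)/Bb].
have inj_f : injective f.
  by move=> i j /eqP; rewrite nth_uniq // => /eqP/val_inj.
exists (f @: [set: 'I_4]), f; split=> //.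
  by apply/subsetP=> _ /imsetP[i _ ->].
move=> u v; have [-> | nuv] := eqVneq u v.
  rewrite /enhanced_power_rel /= eqxx !andbF.
  by case: v => [[|[|[|[|]]]] ?].
rewrite enhanced_power_edgeP ?(inj_eq inj_f) //.
case: u v nuv => [[|[|[|[|//]]]] i4] [[|[|[|[|//]]]] j4] //= _;
  rewrite /f /cycle4_rel /=; try exact: negbTE; try exact: cab;
  rewrite gen2C; try exact: negbTE; exact: cab.
Qed.
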